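(* Let $\lambda\in\mathbb{R}$, let $r\ge 0$ be an integer, and let $f(x)\in\mathbb{C}[[x]]$ be a formal power series. For every integer $n\ge 0$, $$(xD+r)_{n,\lambda}f(x)=\sum_{k=0}^{n}{n+r \brace k+r}_{r,\lambda}x^{k}D^{k}f(x).$$
   Context: $D=\frac{d}{dx}$ acts on formal power series $\mathbb{C}[[x]]$, and $x$ acts by multiplication; products of operators are compositions. For $\lambda\in\mathbb{R}$ and $y$ a number, indeterminate or operator, $(y)_{0,\lambda}=1$ and $(y)_{n,\lambda}=y(y-\lambda)(y-2\lambda)\cdots(y-(n-1)\lambda)$ for $n\ge 1$. Also $(y)_{0}=1$ and $(y)_{n}=y(y-1)\cdots(y-n+1)$ for $n\ge1$. For an integer $r\ge 0$, the degenerate $r$-Stirling numbers of the second kind ${n+r \brace k+r}_{r,\lambda}$ ($0\le k\le n$) are defined by the polynomial identity $$(y+r)_{n,\lambda}=\sum_{k=0}^{n}{n+r \brace k+r}_{r,\lambda}(y)_{k}\quad (n\ge 0).$$ *)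

(* Defs.v *)
From HB Require Import structures.
From mathcomp Require Import all_boot all_order all_algebra.
From mathcomp Require Import boolp classical_sets functions reals.
From mathcomp Require Import complex.

Set Implicit Arguments.
Unset Strict Implicit.
Unset Printing Implicit Defensive.

Import GRing.Theory.
Local Open Scope ring_scope.

(* In a K-algebra A (numbers, polynomials, operators) the scalar i * lam stands
   for (i * lam) *: 1; all the factors commute with one another. *)
Definition dfall (K : nzRingType) (A : lalgType K) (lam : K) (y : A) (n : nat)
    : A :=
  \prod_(i < n) (y - (lam *+ i)%:A).

Definition fall (A : pzRingType) (y : A) (n : nat) : A :=
  \prod_(i < n) (y - i%:R).

Section DegenerateStirling.
Variables (K : fieldType) (lam : K) (r : nat).

Let fallS (A : pzRingType) (y : A) n : fall y n.+1 = fall y n * (y - n%:R).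
Proof. by rewrite /fall big_ord_recr. Qed.

(* The numbers with k > n do not occur in the defining identity; they are set
   to 0. *)
Lemma drstirling2_exists (n : nat) : exists S : nat -> K,
  (forall k, (n < k)%N -> S k = 0) /\
  dfall lam ('X + r%:R : {poly K}) n = \sum_(k < n.+1) S k *: fall 'X k.
Proof.
elim: n => [|n [S [S0 IH]]].
  exists (fun k => (k == 0%N)%:R); split; first by case.
  by rewrite /dfall big_ord0 big_ord1 /fall big_ord0 scale1r.
exists (fun k => (if k is k'.+1 then S k' else 0)
                 + (k%:R + r%:R - lam *+ n) * S k); split.
  case=> // k; rewrite ltnS => ltnk.
  by rewrite !S0 ?addr0 ?mulr0 ?addr0 // ltnW.
rewrite /dfall big_ord_recr /= -/(dfall _ _ _) IH.
under [RHS]eq_bigr do rewrite scalerDl.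
rewrite big_split /= [X in _ = X + _]big_ord_recl /= scale0r add0r.
rewrite [X in _ = _ + X]big_ord_recr /= (S0 n.+1) // mulr0 scale0r addr0.
rewrite mulr_suml -big_split /=; apply: eq_bigr => k _.
rewrite /bump /= add1n fallS [_ * S k]mulrC -scalerA -scalerAl -scalerDr.
congr (_ *: _); rewrite -[(_ + _ - _) *: _]mulr_algr -mulrDr; congr (_ * _).
by rewrite scalerBl scalerDl !scaler_nat -!addrA addKr.
Qed.

(* drstirling2 lam r n k is {n+r \brace k+r}_{r,lam} *)
Definition drstirling2 (n : nat) : nat -> K :=
  sval (cid (drstirling2_exists n)).

Lemma drstirling2P (n : nat) :
  dfall lam ('X + r%:R : {poly K}) n
    = \sum_(k < n.+1) drstirling2 n k *: fall 'X k.
Proof. by rewrite /drstirling2; case: cid => S []. Qed.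

Lemma drstirling2_unique (n : nat) (S : nat -> K) :
  dfall lam ('X + r%:R : {poly K}) n = \sum_(k < n.+1) S k *: fall 'X k ->
  forall k, (k <= n)%N -> S k = drstirling2 n k.
Proof.
rewrite drstirling2P => /esym/eqP; rewrite -subr_eq0 -sumrB.
under eq_bigr do rewrite -scalerBl.
have fallE k : fall ('X : {poly K}) k
    = \prod_(x <- [seq i%:R | i <- iota 0 k]) ('X - x%:P).
  rewrite big_map /fall -(big_mkord xpredT
    (fun i => 'X - i%:R : {poly K})) /index_iota subn0.
  by apply: eq_bigr => i _; rewrite polyC_natr.
elim: n (drstirling2 n) => [|n IH] T.
  rewrite big_ord1 /fall big_ord0 scaler_eq0 oner_eq0 orbF subr_eq0.
  by move=> /eqP e [|].
rewrite big_ord_recr /= => /eqP e.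
have sz k : size (fall ('X : {poly K}) k) = k.+1.
  by rewrite fallE size_prod_XsubC size_map size_iota.
have c0 : S n.+1 - T n.+1 = 0.
  have := congr1 (fun p : {poly K} => p`_n.+1) e.
  rewrite coef0 coefD coef_sum big1 => [|k _]; last first.
    by rewrite coefZ nth_default ?mulr0 // sz.
  have := monicP (monic_prod_XsubC [seq i%:R : K | i <- iota 0 n.+1] xpredT id).
  by rewrite lead_coefE -fallE sz add0r coefZ /= => ->; rewrite mulr1.
move: e; rewrite c0 scale0r addr0 => /eqP/IH H k.
by rewrite leq_eqVlt => /orP[/eqP->|/H//]; apply/eqP; rewrite -subr_eq0 c0.
Qed.

End DegenerateStirling.

(* K[[x]]; f n is the coefficient of x^n. *)
Definition fps (K : Type) := nat -> K.

HB.instance Definition _ (K : comNzRingType) :=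
  GRing.Zmodule.copy (fps K) (nat -> K).
HB.instance Definition _ (K : comNzRingType) :=
  GRing.Lmodule.copy (fps K) (nat -> K^o).

Section FormalPowerSeries.
Variable K : comNzRingType.
Implicit Types f g h : fps K.

Definition fps1 : fps K := fun n => (n == 0%N)%:R.

Definition fpsmul f g : fps K := fun n => \sum_(i < n.+1) f i * g (n - i)%N.

Let tr N f : {poly K} := \poly_(i < N.+1) f i.

Let trE N f n : (n <= N)%N -> (tr N f)`_n = f n.
Proof. by move=> le; rewrite coef_poly ltnS le. Qed.

Let fpsmulE N f g n : (n <= N)%N -> fpsmul f g n = (tr N f * tr N g)`_n.
Proof.
move=> le; rewrite coefM; apply: eq_bigr => i _.
have lei : (i <= n)%N by rewrite -ltnS.
by rewrite !trE // ?(leq_trans lei) // (leq_trans (leq_subr _ _)).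
Qed.

Let fpsmulC : commutative fpsmul.
Proof. by move=> f g; apply/funext => n; rewrite !(fpsmulE _ _ (leqnn n)) mulrC. Qed.

Let fpsmulA : associative fpsmul.
Proof.
move=> f g h; apply/funext => n.
transitivity ((tr n f * (tr n g * tr n h))`_n).
  rewrite coefM; apply: eq_bigr => i _; rewrite trE; last by rewrite -ltnS.
  by rewrite (@fpsmulE n) // leq_subr.
rewrite mulrA coefM; apply: eq_bigr => i _; rewrite trE ?leq_subr //.
by rewrite (@fpsmulE n) // -ltnS.
Qed.

Let fpsmul1 : left_id fps1 fpsmul.
Proof.
move=> f; apply/funext => n; rewrite /fpsmul big_ord_recl subn0 mul1r.
by rewrite big1 ?addr0 // => i _; rewrite mul0r.
Qed.

Let fpsmulDl : left_distributive fpsmul +%R.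
Proof.
move=> f g h; apply/funext => n; rewrite /fpsmul -[RHS]big_split /=.
by apply: eq_bigr => i _; rewrite -mulrDl.
Qed.

Let fps1_neq0 : fps1 != 0.
Proof. by apply/eqP => /(congr1 (@^~ 0%N))/eqP; rewrite oner_eq0. Qed.

HB.instance Definition _ := GRing.Zmodule_isComNzRing.Build (fps K)
  fpsmulA fpsmulC fpsmul1 fpsmulDl fps1_neq0.

Definition fpsX : fps K := fun n => (n == 1%N)%:R.

Definition fpsderiv f : fps K := fun n => f n.+1 *+ n.+1.

Definition fpsmulX f : fps K := fpsX * f.

Lemma fpsmulX_linear : linear fpsmulX.
Proof.
move=> a f g; rewrite /fpsmulX mulrDr; congr (_ + _); apply/funext => n.
rewrite [RHS]mulr_sumr; apply: eq_bigr => i _; exact: mulrCA.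
Qed.

Lemma fpsderiv_linear : linear fpsderiv.
Proof.
move=> a f g; apply/funext => n.
by rewrite -[RHS]/(a * (f n.+1 *+ n.+1) + g n.+1 *+ n.+1) mulrnAr -mulrnDl.
Qed.

HB.instance Definition _ :=
  GRing.isLinear.Build K (fps K) (fps K) _ fpsmulX fpsmulX_linear.
HB.instance Definition _ :=
  GRing.isLinear.Build K (fps K) (fps K) _ fpsderiv fpsderiv_linear.

End FormalPowerSeries.

(* The K-linear operators on K[[x]]: an algebra under composition. *)
Definition fpsop (K : comNzRingType) := {linear fps K -> fps K}.

Section OperatorAlgebra.
Variable K : comNzRingType.
Implicit Types S T U : fpsop K.

Definition fpsop_app T : fps K -> fps K := T.

HB.instance Definition _ := gen_eqMixin (fpsop K).
HB.instance Definition _ := gen_choiceMixin (fpsop K).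

Lemma fpsopP S T : fpsop_app S =1 fpsop_app T -> S = T.
Proof.
case: S T => [S [[S1] [S2]]] [T [[T1] [T2]]] /funext /= e.
rewrite /fpsop_app /= in e; subst T.
by rewrite (Prop_irrelevance S1 T1) (Prop_irrelevance S2 T2).
Qed.

Definition fpsop0 : fpsop K := \0 : {linear fps K -> fps K}.
Definition fpsopN S : fpsop K := \- (S : {linear _ -> _}) : {linear _ -> _}.
Definition fpsopD S T : fpsop K :=
  (S : {linear _ -> _}) \+ (T : {linear _ -> _}) : {linear _ -> _}.
Definition fpsopZ (a : K) S : fpsop K :=
  a \*: (S : {linear _ -> _}) : {linear _ -> _}.
Definition fpsop1 : fpsop K := idfun : {linear fps K -> fps K}.
Definition fpsop_comp S T : fpsop K :=
  (S : {linear _ -> _}) \o (T : {linear _ -> _}) : {linear _ -> _}.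

Let addA : associative fpsopD.
Proof. by move=> S T U; apply: fpsopP => f; apply: addrA. Qed.

Let addC : commutative fpsopD.
Proof. by move=> S T; apply: fpsopP => f; apply: addrC. Qed.

Let add0 : left_id fpsop0 fpsopD.
Proof. by move=> S; apply: fpsopP => f; apply: add0r. Qed.

Let addN : left_inverse fpsop0 fpsopN fpsopD.
Proof. by move=> S; apply: fpsopP => f; apply: addNr. Qed.

HB.instance Definition _ :=
  GRing.isZmodule.Build (fpsop K) addA addC add0 addN.

Let compA : associative fpsop_comp.
Proof. by move=> S T U; apply: fpsopP. Qed.

Let comp1l : left_id fpsop1 fpsop_comp.
Proof. by move=> S; apply: fpsopP. Qed.

Let comp1r : right_id fpsop1 fpsop_comp.
Proof. by move=> S; apply: fpsopP. Qed.

Let compDl : left_distributive fpsop_comp +%R.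
Proof. by move=> S T U; apply: fpsopP. Qed.

Let compDr : right_distributive fpsop_comp +%R.
Proof.
move=> S T U; apply: fpsopP => f.
exact: (raddfD (S : {linear fps K -> fps K})).
Qed.

Let one_neq0 : fpsop1 != 0.
Proof.
apply/eqP => /(congr1 (fun T => fpsop_app T 1 0%N))/eqP.
by rewrite oner_eq0.
Qed.

HB.instance Definition _ := GRing.Zmodule_isNzRing.Build (fpsop K)
  compA comp1l comp1r compDl compDr one_neq0.

Let scaleA a b S : fpsopZ a (fpsopZ b S) = fpsopZ (a * b) S.
Proof. by apply: fpsopP => f; apply: scalerA. Qed.

Let scale1 : left_id 1 fpsopZ.
Proof. by move=> S; apply: fpsopP => f; apply: scale1r. Qed.

Let scaleDr : right_distributive fpsopZ +%R.
Proof. by move=> a S T; apply: fpsopP => f; apply: scalerDr. Qed.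

Let scaleDl S : {morph fpsopZ^~ S : a b / a + b}.
Proof. by move=> a b; apply: fpsopP => f; apply: scalerDl. Qed.

HB.instance Definition _ := GRing.Zmodule_isLmodule.Build K (fpsop K)
  scaleA scale1 scaleDr scaleDl.

Let scaleAl (a : K) S T : a *: (S * T) = (a *: S) * T.
Proof. by apply: fpsopP. Qed.

HB.instance Definition _ := GRing.Lmodule_isLalgebra.Build K (fpsop K) scaleAl.

Definition opX : fpsop K := @fpsmulX K : {linear fps K -> fps K}.
Definition opD : fpsop K := @fpsderiv K : {linear fps K -> fps K}.

End OperatorAlgebra.

Arguments opX {K}.
Arguments opD {K}.

(* Main.v *)
(* The operator [x D] is diagonal on the monomials: it multiplies the coefficient of
   [x^m] by [m], while [x^k D^k] multiplies it by [(m)_k]. The identity is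
   therefore the defining polynomial identity evaluated at [y = m], for every [m]. *)
Require Import Defs.
From HB Require Import structures.
From mathcomp Require Import all_boot all_order all_algebra.
From mathcomp Require Import boolp classical_sets functions reals.
From mathcomp Require Import complex.
Import GRing.Theory.
Local Open Scope ring_scope.

Section Coefficients.
Variable K : comNzRingType.
Implicit Types f : fps K.

Lemma fps_sumE (I : Type) (s : seq I) (P : pred I) (F : I -> fps K) (m : nat) :
  (\sum_(i <- s | P i) F i) m = \sum_(i <- s | P i) F i m.
Proof. exact: (big_morph (fun f : fps K => f m)). Qed.

Lemma fpsmulX_coef f (m : nat) :
  fpsmulX f m = if m is m'.+1 then f m' else 0.
Proof.
rewrite /fpsmulX; change (fpsmul (fpsX K) f m = if m is m'.+1 then f m' else 0).
rewrite /fpsmul /fpsX big_ord_recl mul0r add0r.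
case: m => [|m]; first by rewrite big_ord0.
rewrite big_ord_recl /= mul1r subSS subn0 big1 ?addr0 // => i _.
by rewrite mul0r.
Qed.

Lemma fpsop_app_natr (r : nat) f : fpsop_app r%:R f = f *+ r.
Proof.
elim: r => [|r IH]; first by rewrite mulr0n.
by rewrite -addn1 natrD mulrnDr -IH.
Qed.

Lemma fps_mulrn_coef f (r m : nat) : (f *+ r) m = f m *+ r.
Proof. by elim: r => [|r IH] //; rewrite !mulrS -IH. Qed.

Lemma opXD_coef f (m : nat) : fpsop_app (opX * opD) f m = m%:R * f m.
Proof.
change (fpsmulX (fpsderiv f) m = m%:R * f m).
by rewrite fpsmulX_coef; case: m => [|m]; rewrite ?mul0r // mulr_natl.
Qed.

(** Each factor of the operator product multiplies the coefficient of [x^m] by its own scalar. The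
    last factor acts first, so the induction on [n] has to hold for every series. *)
Lemma dfall_opXD_coef (c : K) (r n : nat) f (m : nat) :
  fpsop_app (dfall c (opX * opD + r%:R) n) f m
  = \prod_(i < n) (m%:R + r%:R - c *+ i) * f m.
Proof.
elim: n f => [|n IH] f; first by rewrite /dfall !big_ord0 mul1r.
rewrite /dfall !big_ord_recr /= -/(dfall _ _ _) -mulrA.
pose T : fpsop K := opX * opD + r%:R - (c *+ n)%:A.
change (fpsop_app (dfall c (opX * opD + r%:R) n) (fpsop_app T f) m
  = \prod_(i < n) (m%:R + r%:R - c *+ i) * ((m%:R + r%:R - c *+ n) * f m)).
(* The induction hypothesis is used at the series [T f]; only the action of the single factor [T] is
   left. *)
rewrite IH; congr (_ * _).
change (fpsop_app (opX * opD) f m + fpsop_app r%:R f m - (c *+ n) * f m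
  = (m%:R + r%:R - c *+ n) * f m).
rewrite opXD_coef fpsop_app_natr fps_mulrn_coef mulrBl mulrDl.
by rewrite [r%:R * _]mulr_natl.
Qed.

(** Induction through [x^(k+1) D^(k+1) = x (x^k D^k) D]: the outer [x] shifts the index, the inner
    [D] contributes [m+1], and [(m+1) (m)_k = (m+1)_(k+1)]. *)
Lemma opXnDn_coef (k : nat) f (m : nat) :
  fpsop_app (opX ^+ k * opD ^+ k) f m = fall m%:R k * f m.
Proof.
elim: k f m => [|k IH] f m; first by rewrite /fall big_ord0 mul1r.
rewrite exprS exprSr mulrA -[opX * _ * _]mulrA -mulrA.
change (fpsmulX (fpsop_app (opX ^+ k * opD ^+ k) (fpsderiv f)) m
  = fall m%:R k.+1 * f m).
rewrite fpsmulX_coef /fall big_ord_recl subr0.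
(* At [m = 0] the leading factor of the falling factorial vanishes, as does the constant term of a
   multiple of [x]. *)
case: m => [|m]; first by rewrite !mul0r.
rewrite IH /fpsderiv -[f _ *+ _]mulr_natl mulrA [X in X * _]mulrC.
congr (_ * _ * _); apply: eq_bigr => i _.
by rewrite lift0 !mulrS opprD addrACA subrr add0r.
Qed.

End Coefficients.

Lemma drstirling2_horner (K : fieldType) (lam y : K) (r n : nat) :
  \prod_(i < n) (y + r%:R - lam *+ i)
  = \sum_(k < n.+1) drstirling2 lam r n k * fall y k.
Proof.
have /(congr1 (fun p : {poly K} => p.[y])) := drstirling2P lam r n.
rewrite /dfall horner_prod horner_sum.
under eq_bigr do rewrite -polyC_natr alg_polyC !hornerE.
move=> ->; apply: eq_bigr => k _; rewrite hornerZ /fall horner_prod.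
by congr (_ * _); apply: eq_bigr => i _; rewrite -polyC_natr !hornerE.
Qed.

Theorem theorem5 (R : realType) (lam : R) (r : nat) (f : fps R[i]) (n : nat) :
  fpsop_app (dfall (lam%:C)%C (opX * opD + r%:R) n) f
  = \sum_(k < n.+1)
      (drstirling2 lam r n k)%:C%C *: fpsop_app (opX ^+ k * opD ^+ k) f.
Proof.
apply/funext => m; rewrite dfall_opXD_coef fps_sumE.
(* The Stirling numbers are real and the coefficients of [f] complex: the identity is evaluated at
   [m] over [R], then carried to [R[i]] by the ring embedding. *)
have /(congr1 (real_complex R)) := drstirling2_horner _ lam m%:R r n.
rewrite rmorph_prod rmorph_sum /=.
under eq_bigr do rewrite rmorphB rmorphD !rmorph_nat rmorphMn /=.
move=> ->; rewrite mulr_suml; apply: eq_bigr => k _.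
change ((drstirling2 lam r n k * fall m%:R k)%:C%C * f m
  = (drstirling2 lam r n k)%:C%C * fpsop_app (opX ^+ k * opD ^+ k) f m).
rewrite opXnDn_coef rmorphM /= mulrA; congr (_ * _ * _).
rewrite /fall rmorph_prod; apply: eq_bigr => i _.
by rewrite rmorphB !rmorph_nat.
Qed.
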